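(* There exist infinitely many (pairwise non-isomorphic) trees whose optimal-pegging number increases with the removal of a leaf; that is, infinitely many trees $T$ having a leaf $\ell$ such that $p(T-\ell)>p(T)$, where $p$ denotes the optimal-pegging number and $T-\ell$ is the tree obtained from $T$ by deleting $\ell$ and its incident edge.
   Context: A distribution $D$ of pegs on a graph $G$ is a subset of $V(G)$ (the vertices holding one peg each). A pegging move from $D$ to $D'$: there are distinct vertices $u,v\in D$ and $w\notin D$ with both $u$ and $w$ adjacent to $v$, and $D'=(D\setminus\{u,v\})\cup\{w\}$. A vertex $x$ is reachable from $D$ if some finite (possibly empty) sequence of pegging moves starting at $D$ yields a distribution containing $x$. The reach $R(D)$ is the set of vertices reachable from $D$; $G$ can be pegged by $D$ if $R(D)=V(G)$. The optimal-pegging number $p(G)$ is the minimum size of a distribution on $G$ that can peg $G$. *)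

(* Defs.v *)
From HB Require Import structures.
From mathcomp Require Import all_boot.

Set Implicit Arguments.
Unset Strict Implicit.
Unset Printing Implicit Defensive.

Record sgraph := SGraph {
  vertex :> finType;
  adj : rel vertex;
  adj_sym : symmetric adj;
  adj_irrefl : irreflexive adj }.

Definition graph_iso (G H : sgraph) : Prop :=
  exists2 f : G -> H, bijective f & forall x y, adj (f x) (f y) = adj x y.

Definition connected (G : sgraph) : Prop :=
  forall x y : G, connect (@adj G) x y.

(* The bound on the size excludes x :: y :: nil, which is a ucycle for every
   edge xy because adj is symmetric. *)
Definition acyclic (G : sgraph) : Prop :=
  forall c : seq G, 2 < size c -> ~~ ucycleb (@adj G) c.

Definition is_tree (G : sgraph) : Prop :=
  [/\ 0 < #|G|, connected G & acyclic G].

Definition degree (G : sgraph) (x : G) : nat := #|[set y | adj x y]|.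

Definition leaf (G : sgraph) (x : G) : bool := degree x == 1.

Section DeleteVertex.
Variables (G : sgraph) (x : G).

Definition del_adj : rel {y : G | y != x} := fun y z => adj (val y) (val z).

Lemma del_adj_sym : symmetric del_adj.
Proof. by move=> y z; apply: adj_sym. Qed.

Lemma del_adj_irrefl : irreflexive del_adj.
Proof. by move=> y; apply: adj_irrefl. Qed.

Definition del_vertex : sgraph := SGraph del_adj_sym del_adj_irrefl.
End DeleteVertex.

Section Pegging.
Variable G : sgraph.
Implicit Types (D : {set G}) (x : G).

Definition peg_move : rel {set G} := fun D D' =>
  [exists u, exists v, exists w,
    [&& u \in D, v \in D, u != v, w \notin D, adj u v, adj w v
      & D' == w |: (D :\: [set u; v])]].

Definition reachable D x : bool :=
  [exists D', connect peg_move D D' && (x \in D')].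

Definition reach D : {set G} := [set x | reachable D x].

Definition can_peg D : bool := reach D == [set: G].

Definition opt_pegging : nat := #|[arg min_(D < [set: G] | can_peg D) #|D|]|.

(* The default value of the arg min is itself admissible, so the minimum is
   genuine. *)
Lemma can_peg_setT : can_peg [set: G].
Proof.
apply/eqP/setP=> x; rewrite !inE; apply/existsP; exists [set: G].
by rewrite connect0 inE.
Qed.

Lemma opt_peggingP :
  (exists2 D, can_peg D & #|D| = opt_pegging) /\
  (forall D, can_peg D -> opt_pegging <= #|D|).
Proof.
rewrite /opt_pegging; case: arg_minnP => [|D pD minD]; first exact: can_peg_setT.
by split; [exists D | exact: minD].
Qed.
End Pegging.

(* Main.v *)
Require Import Defs.
From mathcomp Require Import all_boot.
From mathcomp Require Import all_order all_algebra.
From mathcomp Require Import zify lra.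

(** The trees are complete binary trees of depth [d] whose root carries in
    addition a number of arms, paths with two vertices.  Arms are ammunition:
    with both vertices of an arm pegged, one jump puts a peg on the root at the
    price of that arm.

    With enough arms, pegging the arms alone is a good distribution.  A vertex
    at depth [j + 2] is pegged by a jump from its grandparent over its parent,
    so the number of arms needed to reach depth [j] satisfies the Fibonacci
    recursion ([arm_cost]), and the optimal-pegging number is of the order of
    [phi ^ d] with [phi] the golden ratio ([opt_pegging_arms]).

    Without arms there is too little room near the root.  Give a vertex at
    distance [t] of a target the weight [r ^ t], where [r + r ^ 2 >= 1]; then
    no pegging move increases the total weight, so a target of weight [1] is
    reachable only from distributions of weight at least [1].  The vertices that
    hang from the path between a deepest leaf and the root at height [n], about
    [2 ^ n] of them and most at distance about [2 * n] from the leaf, weigh at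
    most a constant times [(2 * r ^ 2) ^ n].  If moreover [2 * r ^ 2 < 1], the
    total weight of all the vertices outside the subtree of height [h] that
    contains the leaf is therefore a geometric tail in [h].  For [h] large (here [r = 2 / 3] and
    [h = 24]) this is less than [1] even when every outside vertex is pegged,
    so each of the [2 ^ (d - h)] subtrees of height [h] must contain a peg
    ([opt_pegging_binary]).

    As [phi < 2], for [d] large the tree with all its arms has a smaller
    optimal-pegging number than the bare binary tree.  The first arises from
    the second by adding leaves one at a time, so one of these additions lowers
    the number ([opt_pegging_drop]); removing that leaf again raises it.  Trees
    found for different depths have different sizes. *)

Set Implicit Arguments.
Unset Strict Implicit.
Unset Printing Implicit Defensive.

(** * Pegging moves up to domination *)

Section Pegging.
Variable G : sgraph.
Implicit Types (D E F : {set G}) (x u v w : G).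

(** Reachability of at least the pegs of [E].  Working up to superfluous pegs
    removes the condition that the destination of a jump be empty: if it is
    already pegged, the jump is skipped. *)
Definition dominates D E := exists2 D', connect (@peg_move G) D D' & E \subset D'.

Lemma dominates_sub D E : E \subset D -> dominates D E.
Proof. by move=> sED; exists D. Qed.

(** Additional pegs never hurt: a move blocked by an additional peg on its
    destination has already achieved its purpose. *)
Lemma peg_move_mono D E D' :
  D \subset E -> peg_move D D' -> dominates E D'.
Proof.
move=> sDE /existsP[u /existsP[v /existsP[w]]].
case/and5P=> Du Dv uv Dw /and3P[auv awv /eqP->].
have [Ew|Ew] := boolP (w \in E).
  apply: dominates_sub; rewrite subUset sub1set Ew /=.
  exact: subset_trans (subsetDl _ _) sDE.
exists (w |: (E :\: [set u; v])); last by rewrite setUS // setSD.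
apply: connect1; apply/existsP; exists u; apply/existsP; exists v.
by apply/existsP; exists w; rewrite uv Ew auv awv eqxx (subsetP sDE u) // (subsetP sDE v).
Qed.

Lemma dominates_trans D E F : dominates D E -> dominates E F -> dominates D F.
Proof.
move=> [D' DD' sED'] [F' /connectP[p Ep ->{F'}] sF].
elim: p E D D' DD' sED' Ep sF => [|E' p IHp] E D D' DD' sED' /=.
  by move=> _ sFE; exists D' => //; apply: subset_trans sFE sED'.
case/andP=> EE' E'p sF.
have [D'' D'D'' sE'D''] := peg_move_mono sED' EE'.
exact: IHp (connect_trans DD' D'D'') sE'D'' E'p sF.
Qed.

Lemma dominates_jump D u v w : u \in D -> v \in D -> u != v ->
  adj u v -> adj w v -> dominates D (w |: (D :\: [set u; v])).
Proof.
move=> Du Dv uv auv awv; have [Dw|Dw] := boolP (w \in D).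
  by apply: dominates_sub; rewrite subUset sub1set Dw subsetDl.
exists (w |: (D :\: [set u; v])) => //; apply: connect1.
apply/existsP; exists u; apply/existsP; exists v; apply/existsP; exists w.
by rewrite Du Dv uv Dw auv awv eqxx.
Qed.

Lemma dominates_reachable D E x : dominates D E -> x \in E -> reachable D x.
Proof.
by case=> D' DD' sED' Ex; apply/existsP; exists D'; rewrite DD' (subsetP sED').
Qed.

End Pegging.

(** * Invariance under isomorphism *)

Lemma iso_opt_pegging_le (G H : sgraph) :
  graph_iso G H -> opt_pegging H <= opt_pegging G.
Proof.
case=> f bij_f f_adj; have inj_f := bij_inj bij_f.
have [[D pD <-] _] := opt_peggingP G; have [_ minH] := opt_peggingP H.
apply: leq_trans (minH (f @: D) _) (leq_imset_card _ _).
have f_move E F : peg_move E F -> peg_move (f @: E) (f @: F).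
  move=> /existsP[u /existsP[v /existsP[w]]].
  case/and5P=> Eu Ev uv Ew /and3P[auv awv /eqP->].
  apply/existsP; exists (f u); apply/existsP; exists (f v).
  apply/existsP; exists (f w); rewrite !f_adj auv awv !mem_imset // Eu Ev Ew.
  rewrite inj_eq // uv /= imsetU1; apply/eqP; congr (_ |: _).
  apply/setP=> y; have [g gK Kg] := bij_f; rewrite -(Kg y).
  by rewrite !(inE, mem_imset, inj_eq inj_f).
have f_connect E F : connect (@peg_move G) E F ->
    connect (@peg_move H) (f @: E) (f @: F).
  case/connectP=> p Ep ->; elim: p E Ep => [|E' p IHp] E /=.
    by rewrite connect0.
  by case/andP=> /f_move/connect1 EE' /IHp; apply: connect_trans.
apply/eqP/setP=> y; rewrite !inE; have [g gK Kg] := bij_f.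
have: g y \in reach D by rewrite (eqP pD) inE.
rewrite inE => /existsP[E /andP[DE Ey]]; apply/existsP; exists (f @: E).
by rewrite f_connect // -[y]Kg mem_imset.
Qed.

Lemma graph_iso_sym (G H : sgraph) : graph_iso G H -> graph_iso H G.
Proof.
case=> f [g gK Kg] f_adj; exists g; first by exists f.
by move=> x y; rewrite -f_adj !Kg.
Qed.

Lemma iso_opt_pegging (G H : sgraph) :
  graph_iso G H -> opt_pegging G = opt_pegging H.
Proof.
move=> isoGH; apply/eqP; rewrite eqn_leq !iso_opt_pegging_le //.
exact: graph_iso_sym.
Qed.

Lemma iso_card (G H : sgraph) : graph_iso G H -> #|G| = #|H|.
Proof. by case=> f bij_f _; apply: bij_eq_card bij_f. Qed.

(** * Trees from a parent function *)

(** The partial parent function is undefined at roots; the rank, which grows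
    from parent to child, rules out loops and provides induction. *)
Section ParentTree.
Variables (V : finType) (par : V -> option V) (rank : V -> nat).
Hypothesis rank_par : forall x y, par x = Some y -> rank y < rank x.

Definition par_adj : rel V := fun x y => (par x == Some y) || (par y == Some x).

Lemma par_adj_sym : symmetric par_adj.
Proof. by move=> x y; rewrite /par_adj orbC. Qed.

Lemma par_adj_irrefl : irreflexive par_adj.
Proof.
by move=> x; apply/negP; rewrite /par_adj orbb => /eqP/rank_par; rewrite ltnn.
Qed.

Definition par_graph := SGraph par_adj_sym par_adj_irrefl.

(** On a cycle, both neighbours of a vertex of maximal rank are its parent. *)
Lemma par_acyclic : acyclic par_graph.
Proof.
move=> c sz_c; apply/negP=> /andP[cyc_c uniq_c].
have [x0 c_x0] : exists x0 : V, x0 \in c.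
  by case: c sz_c {cyc_c uniq_c} => // x c _; exists x; rewrite mem_head.
have [x c_x max_x] := arg_maxnP rank c_x0.
have nbr y : y \in c -> par_adj x y -> par x = Some y.
  move=> c_y /orP[/eqP-> //|/eqP/rank_par]; rewrite ltnNge.
  by have /= -> := max_x _ c_y.
have [i p def_c] := rot_to c_x.
move: sz_c cyc_c uniq_c nbr; rewrite -(size_rot i) -(rot_cycle i) -(rot_uniq i).
have mem_c y : (y \in c) = (y \in rot i c) by rewrite mem_rot.
move=> sz_c cyc_c uniq_c nbr; move: sz_c cyc_c uniq_c mem_c; rewrite {}def_c.
case/lastP: p => [|[|y p] z] //= _.
rewrite rcons_path last_rcons => /andP[xy /andP[_ zx]] /and3P[_ yNpz _] mem_c.
have Ny : par x = Some y by apply: nbr xy; rewrite mem_c !inE eqxx orbT.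
have Nz : par x = Some z.
  by apply: nbr; [rewrite mem_c !inE mem_rcons mem_head !orbT | rewrite par_adj_sym].
by case/negP: yNpz; move: Ny; rewrite Nz => -[->]; rewrite mem_rcons mem_head.
Qed.

Lemma par_tree r : (forall x, par x = None -> x = r) -> is_tree par_graph.
Proof.
move=> root_r; split; [by apply/card_gt0P; exists r| |exact: par_acyclic].
suff to_r x : connect par_adj x r.
  move=> x y; apply: connect_trans (to_r x) _.
  by rewrite (sym_connect_sym par_adj_sym).
have [n] := ubnP (rank x); elim: n x => // n IHn x.
case Px: (par x) => [y|] lt_x; last by rewrite (root_r x Px) connect0.
apply: connect_trans (connect1 _) (IHn y _); first by rewrite /par_adj Px eqxx.
exact: leq_trans (rank_par Px) lt_x.
Qed.

End ParentTree.

(** * A weight that no pegging move increases *)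

Section Weight.
Import Order.TTheory GRing.Theory Num.Theory.
Local Open Scope ring_scope.

(** Any number with [1 <= r + r ^ 2] and [2 * r ^ 2 < 1] would do, that is, any
    number from [1 / phi] up to [1 / sqrt 2], with a suitable height of the
    blocks; a rational one keeps all the computations exact. *)
Definition ratio : rat := 2%:R / 3%:R.

Lemma ratio_ge0 n : 0 <= ratio ^+ n.
Proof. by rewrite exprn_ge0. Qed.

Lemma ratio_anti m n : (m <= n)%N -> ratio ^+ n <= ratio ^+ m.
Proof. by move=> le_mn; rewrite ler_wiXn2l. Qed.

Variables (G : sgraph) (d : G -> nat).
Hypothesis d_lip : forall x y, adj x y -> (d x <= (d y).+1)%N.

Definition weight (D : {set G}) : rat := \sum_(z in D) ratio ^+ d z.

(** In a jump from [u] over [v] to [w], the peg [v] is at most one step and [u]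
    at most two steps further than [w], and [1 <= r + r ^ 2].  Only the
    Lipschitz property of [d] matters, so [d] need not be a distance. *)
Lemma weight_peg_move D D' : peg_move D D' -> weight D' <= weight D.
Proof.
move=> /existsP[u /existsP[v /existsP[w]]].
case/and5P=> Du Dv uv Dw /and3P[auv awv /eqP->].
rewrite /weight big_setU1 /=; last by rewrite !inE (negbTE Dw) andbF.
rewrite [leRHS](big_setID [set u; v]) /= lerD2r.
rewrite (setIidPr _); last by rewrite subUset !sub1set Du.
rewrite big_setU1 ?inE //= big_set1.
have le_v : ratio ^+ (d w).+1 <= ratio ^+ d v.
  by apply: ratio_anti; apply: d_lip; rewrite adj_sym.
have le_u : ratio ^+ (d w).+2 <= ratio ^+ d u.
  apply: ratio_anti; apply: leq_trans (d_lip auv) _.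
  by rewrite ltnS; apply: d_lip; rewrite adj_sym.
apply: le_trans (lerD le_u le_v).
have := ratio_ge0 (d w); rewrite !exprS.
by set x := _ ^+ _ => x_ge0; rewrite /ratio; lra.
Qed.

Lemma weight_reachable D x : reachable D x -> ratio ^+ d x <= weight D.
Proof.
case/existsP=> E /andP[/connectP[p Dp ->{E}]].
elim: p D Dp => [|E p IHp] D /= => [_ Dx|/andP[DE Ep] /(IHp _ Ep) le_x].
  rewrite /weight (bigD1 x) //= lerDl; apply: sumr_ge0 => y _.
  exact: ratio_ge0.
exact: le_trans le_x (weight_peg_move DE).
Qed.

End Weight.

(** * Complete binary trees *)

(** [None] is the root and [Some (b, x)] is the node [x] of the branch [b]. *)
Fixpoint node d : finType :=
  if d is d'.+1 then option (bool * node d')%type else unit.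

Definition root d : node d :=
  if d is _.+1 return node d then None else tt.

(** The parent of a node of a branch [b] is its parent in that branch; the root
    of the branch has none there, and [omap] then yields [None], which is the
    root of the whole tree. *)
Fixpoint parent d : node d -> option (node d) :=
  if d is d'.+1 return node d -> option (node d) then
    fun x => if x is Some (b, y) then Some (omap (pair b) (parent y)) else None
  else fun _ => None.

Fixpoint depth d : node d -> nat :=
  if d is d'.+1 return node d -> nat then
    fun x => if x is Some (b, y) then (depth y).+1 else 0
  else fun _ => 0.

Lemma parent_root d (x : node d) : parent x = None -> x = root d.
Proof. by case: d x => [[]|d] // [[]|]. Qed.

Lemma depth_root d : depth (root d) = 0.
Proof. by case: d. Qed.

Lemma depth_parent d (x y : node d) : parent x = Some y -> depth x = (depth y).+1.
Proof.
elim: d x y => [[]|d IHd] // [[b x]|] //= y [<-].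
case Px: (parent x) => [z|] /=; first by rewrite (IHd _ _ Px).
by rewrite (parent_root Px) depth_root.
Qed.

Lemma depth_le d (x : node d) : depth x <= d.
Proof. by elim: d x => [|d IHd] // [[b x]|] //=; rewrite ltnS. Qed.

Lemma deepest d : exists x : node d, depth x = d.
Proof.
by elim: d => [|d [x dx]]; [exists tt | exists (Some (true, x)); rewrite /= dx].
Qed.

Lemma card_node d : (#|node d|).+1 = 2 ^ d.+1.
Proof.
elim: d => [|d IHd]; first by rewrite card_unit.
by rewrite card_option card_prod card_bool expnS -IHd mulnS.
Qed.

(** * Blocks of the binary tree *)

Fixpoint address k : finType :=
  if k is k'.+1 then (bool * address k')%type else unit.

Lemma card_address k : #|address k| = 2 ^ k.
Proof.
by elim: k => [|k IHk]; rewrite ?card_unit // card_prod card_bool IHk expnS.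
Qed.

(** The blocks are the subtrees of height [h] rooted at depth [k]; the branches
    followed from the root give the address of a block. *)
Section Blocks.
Variable h : nat.

Fixpoint block k : node (k + h) -> option (address k) :=
  if k is k'.+1 return node (k + h) -> option (address k) then
    fun x => if x is Some (b, y) then omap (pair b) (block y) else None
  else fun _ => Some tt.

(** Outside the block [a] this is the distance to any of its deepest leaves:
    leaving the block costs [h], and a node of the other branch is reached
    through the root.  Inside the block only the Lipschitz property and a zero
    are needed, so the height above the leaves replaces the true distance,
    which would depend on the chosen leaf. *)
Fixpoint target_dist k : address k -> node (k + h) -> nat :=
  if k is k'.+1 return address k -> node (k + h) -> nat then
    fun a x => if x is Some (b, y) then
      if b == a.1 then target_dist a.2 y else (depth y + k' + h).+2
    else (k' + h).+1
  else fun _ x => h - depth x.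

Lemma target_dist_root k (a : address k) : target_dist a (root (k + h)) = k + h.
Proof. by case: k a => [|k] a //=; rewrite depth_root subn0. Qed.

Lemma target_dist_lip k (a : address k) x y : parent x = Some y ->
  (target_dist a x <= (target_dist a y).+1) &&
  (target_dist a y <= (target_dist a x).+1).
Proof.
elim: k a x y => [|k IHk] a x y /=.
  by move/depth_parent=> ->; lia.
case: x => [[b x]|] //= [<-] {y}; case Px: (parent x) => [y|] /=.
  by case: eqP => _; [apply: IHk | rewrite (depth_parent Px); lia].
rewrite (parent_root Px) target_dist_root depth_root; case: eqP => _; lia.
Qed.

Lemma target_dist_target k (a : address k) : exists x, target_dist a x = 0.
Proof.
elim: k a => [|k IHk] a /=.
  by have [x dx] := deepest h; exists x; rewrite dx subnn.
by have [x dx] := IHk a.2; exists (Some (a.1, x)); rewrite eqxx.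
Qed.

Import Order.TTheory GRing.Theory Num.Theory.
Local Open Scope ring_scope.

Lemma sum_node d (F : node d.+1 -> rat) :
  \sum_x F x = F None + \sum_y F (Some (true, y)) + \sum_y F (Some (false, y)).
Proof.
rewrite (bigD1 None) //= -addrA; congr (_ + _).
rewrite (reindex_omap Some id) => [|[]] //=.
rewrite (eq_bigl xpredT) => [|x]; last by rewrite eqxx.
rewrite (eq_bigr (fun p => F (Some (p.1, p.2)))) => [|[]] //.
rewrite -(pair_big xpredT xpredT (fun b y => F (Some (b, y)))) /=.
by rewrite big_bool.
Qed.

(** The [2 ^ i] nodes of depth [i] contribute [(2 * r) ^ i = (4 / 3) ^ i]. *)
Lemma sum_depth d :
  \sum_(x : node d) ratio ^+ depth x = 3%:R * (4%:R / 3%:R) ^+ d.+1 - 3%:R.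
Proof.
elim: d => [|d IHd].
  by rewrite (big_pred1 tt) => [|[]] //=; rewrite expr0 expr1; lra.
rewrite sum_node /= expr0; under eq_bigr do rewrite exprS.
rewrite -mulr_sumr IHd [in RHS]exprS /ratio.
by set y := _ ^+ _; lra.
Qed.

(** One level more adds the root, of weight [r ^ (k + h + 1)], and the other
    branch, which weighs [r ^ (k + h + 2)] times the sum of [sum_depth].
    Together they weigh less than [2 * (8 / 9) ^ (k + h + 1)], where
    [8 / 9 = 2 * r ^ 2], and the bound is the sum of this geometric series. *)
Lemma sum_outside_block k (a : address k) :
  \sum_(x | block x != Some a) ratio ^+ target_dist a x
    <= 18%:R * ((8%:R / 9%:R) ^+ h.+1 - (8%:R / 9%:R) ^+ (k + h).+1).
Proof.
elim: k a => [|k IHk] a.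
  by rewrite big_pred0 => [|x]; rewrite ?subrr ?mulr0 //; case: a => /=;
    rewrite eqxx.
set O := (X in _ <= _ * (_ - X)) in IHk *.
pose S b := \sum_(y | block (Some (b, y) : node (k.+1 + h)) != Some a)
  ratio ^+ target_dist a (Some (b, y) : node (k.+1 + h)).
have S_same : S a.1 = \sum_(y | block y != Some a.2) ratio ^+ target_dist a.2 y.
  apply: eq_big => [y|y _] /=; last by rewrite eqxx.
  case: (block y) => [a'|] //=; case: a {S O IHk} => b a'' /=.
  by rewrite !(inj_eq Some_inj) xpair_eqE eqxx.
have S_other : S (~~ a.1) =
    ratio ^+ (k + h).+2 * \sum_(y : node (k + h)) ratio ^+ depth y.
  rewrite mulr_sumr; apply: eq_big => [y|y _] /=.
    by case: (block y) => [a'|] //=; case: a {S S_same O IHk} => -[] a'' /=.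
  rewrite -exprD; have -> : (~~ a.1 == a.1) = false by case: (a.1).
  by congr (_ ^+ _); rewrite !addSn -addnA [(depth y + _)%N]addnC.
have split_sum b : \sum_(x | block x != Some a) ratio ^+ target_dist a x
    = ratio ^+ (k + h).+1 + (S b + S (~~ b)).
  rewrite big_mkcond sum_node /= -addrA; congr (_ + _).
  by case: b; last rewrite [RHS]addrC; congr (_ + _); rewrite /S [RHS]big_mkcond.
rewrite (split_sum a.1) {split_sum}.
rewrite S_same S_other sum_depth /O addSn; set n := (k + h)%N.
have {IHk} := IHk a.2; rewrite -/n; set s := \sum_(y | _) _.
have ratio_pow m : (8%:R / 9%:R : rat) ^+ m = ratio ^+ m * (4%:R / 3%:R) ^+ m.
  by rewrite -exprMn; congr (_ ^+ _); rewrite /ratio; lra.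
rewrite !(ratio_pow n.+1, ratio_pow n.+2) !(exprS _ n.+1).
set x := _ ^+ h.+1; have := ratio_ge0 n.+1; set y := ratio ^+ n.+1.
by set z := (4%:R / 3%:R) ^+ n.+1; rewrite /ratio; nra.
Qed.

End Blocks.

(** * Binary trees with arms *)

Section Arms.
Variables (d n : nat).

(** The vertices [inr (2 a)] and [inr (2 a + 1)] are the foot, next to the root,
    and the tip of the arm [a].  With [n] odd the last arm consists of its foot
    only, so that raising [n] by one always adds a leaf. *)
Definition armed_parent (x : node d + 'I_n) : option (node d + 'I_n) :=
  match x with
  | inl y => omap inl (parent y)
  | inr i => Some (if odd i then
      inr (Ordinal (leq_ltn_trans (leq_pred i) (ltn_ord i))) else inl (root d))
  end.

Definition armed_rank (x : node d + 'I_n) : nat :=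
  match x with inl y => depth y | inr i => i.+1 end.

Lemma armed_rank_parent x y :
  armed_parent x = Some y -> armed_rank y < armed_rank x.
Proof.
case: x => [x|i] /=; last first.
  by case: ifP => [odd_i|_] [<-] /=; rewrite ?depth_root //; lia.
by case Px: (parent x) => [z|] //= [<-]; rewrite /= (depth_parent Px).
Qed.

Definition armed_tree := par_graph armed_rank_parent.

Lemma armed_adjE (x y : armed_tree) :
  adj x y = (armed_parent x == Some y) || (armed_parent y == Some x).
Proof. by []. Qed.

Lemma armed_tree_is_tree : is_tree armed_tree.
Proof.
apply: (@par_tree _ _ _ _ (inl (root d))) => -[x|i] //=.
by case Px: (parent x) => [y|] // _; rewrite (parent_root Px).
Qed.

Lemma card_armed_tree : (#|armed_tree|).+1 = 2 ^ d.+1 + n.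
Proof. by rewrite card_sum card_ord -addSn card_node. Qed.

End Arms.

Lemma leaf_last_arm d n : leaf (inr ord_max : armed_tree d n.+1).
Proof.
have [z Pz] : exists z, armed_parent (inr ord_max : node d + 'I_n.+1) = Some z.
  by eexists.
(* no child of the last vertex exists, so its parent is its only neighbour *)
rewrite /leaf /degree -(cards1 z); apply/eqP; congr #|pred_of_set _|.
apply/setP=> y; rewrite in_set armed_adjE Pz in_set1 (inj_eq Some_inj) eq_sym.
case: (_ == z) => //=; case: y => [y|i] /=; first by case: (parent y).
case: ifP => //= odd_i; apply/negP=> /eqP[]; have := ltn_ord i.
by move: odd_i; case: (i : nat) => //; lia.
Qed.

Lemma del_last_arm d n :
  graph_iso (armed_tree d n) (del_vertex (inr ord_max : armed_tree d n.+1)).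
Proof.
pose w (x : armed_tree d n) : armed_tree d n.+1 :=
  match x with inl y => inl y | inr i => inr (widen_ord (leqnSn n) i) end.
have w_max x : w x != inr ord_max.
  case: x => [y|i] //; apply/eqP=> -[] eq_in; have := ltn_ord i.
  by rewrite eq_in ltnn.
have inj_w : injective w.
  by case=> [x|i] [y|j] //= [] // => [->|ij] //; congr inr; apply: val_inj.
exists (fun x => exist _ (w x) (w_max x)).
  apply: inj_card_bij => [x y [/inj_w]|] //.
  suff: #|del_vertex (inr ord_max : armed_tree d n.+1)| <= #|armed_tree d n| by [].
  have := card_armed_tree d n; have := card_armed_tree d n.+1.
  rewrite [#|del_vertex _|]card_sig (cardC1 (inr ord_max : armed_tree d n.+1)).
  by rewrite addnS; lia.
move=> x y; rewrite [LHS]armed_adjE [RHS]armed_adjE /=.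
have w_par z : armed_parent (w z) = omap w (armed_parent z).
  case: z => [z|i] /=; first by case: (parent z).
  by case: ifP => // _; congr (Some (inr _)); apply: val_inj.
rewrite !w_par; congr (_ || _); case: (armed_parent _) => //= z.
  by rewrite !(inj_eq Some_inj) inj_eq.
by rewrite !(inj_eq Some_inj) inj_eq.
Qed.

(** * Pegging every vertex from the arms *)

(** The number of arms that [spend_arms] uses to peg a vertex at depth [j]: one
    arm puts a peg on the root, a second one serves to jump from its foot over
    the root, and deeper vertices are reached over their parents. *)
Fixpoint arm_cost j :=
  match j with 0 => 1 | 1 => 2 | (j'.+1 as j1).+1 => arm_cost j1 + arm_cost j' end.

Lemma arm_costSS j : arm_cost j.+2 = arm_cost j.+1 + arm_cost j.
Proof. by []. Qed.

Lemma arm_cost_leS j : arm_cost j <= arm_cost j.+1.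
Proof. by case: j => // j; rewrite arm_costSS leq_addr. Qed.

Lemma arm_cost_mono i j : i <= j -> arm_cost i <= arm_cost j.
Proof.
by move=> /subnK<-; elim: (j - i) => // m /leq_trans; apply; apply: arm_cost_leS.
Qed.

(** Four steps of the recursion multiply by at most [8 < 2 ^ 4]; this is the
    integer form of [phi < 2]. *)
Lemma arm_cost_mul4 m : arm_cost (4 * m) <= 2 ^ (3 * m).
Proof.
elim: m => // m IHm; have -> : 4 * m.+1 = (4 * m).+4 by lia.
rewrite !arm_costSS [3 * _]mulnS expnD.
suff: arm_cost (4 * m).+1 <= 2 * arm_cost (4 * m) by lia.
case: (4 * m) => // j; rewrite arm_costSS; have := arm_cost_leS j; lia.
Qed.

Section Upper.
Variables (d N : nat).
Local Notation T := (armed_tree d N.*2).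

Local Notation inT y := (@inl (node d) 'I_N.*2 y : T).
Local Notation arm i := (@inr (node d) 'I_N.*2 i : T).

(** Pegs on [E] and on all the arms but the first [a], which are spent. *)
Definition stock (E : {set node d}) a : {set T} :=
  [set x : node d + 'I_N.*2 |
    match x with inl y => y \in E | inr i => a.*2 <= i end].

Lemma stock_inl E a y : (inT y \in stock E a) = (y \in E).
Proof. by rewrite inE. Qed.

Lemma stock_inr E a i : (arm i \in stock E a) = (a.*2 <= i).
Proof. by rewrite inE. Qed.

(** One jump from [u] over [v] onto the tree vertex [y], forgetting all the arms
    with index less than [b]. *)
Lemma jump_stock E a (F : {set node d}) b (u v : T) y :
  u \in stock E a -> v \in stock E a -> u != v -> adj u v -> adj (inT y) v ->
  a <= b -> (forall i, (arm i \in [set u; v]) -> i < b.*2) ->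
  (forall z, z \in F -> (z == y) || (z \in E) && (inT z \notin [set u; v])) ->
  dominates (stock E a) (stock F b).
Proof.
move=> Eu Ev uv auv ayv le_ab arms_uv F_sub.
apply: dominates_trans (dominates_jump Eu Ev uv auv ayv) _.
apply: dominates_sub; apply/subsetP=> -[z|i].
  rewrite stock_inl => /F_sub Fz; rewrite in_setU1 in_setD stock_inl.
  by rewrite [_ == inT y](inj_eq inl_inj) [(_ \notin _) && _]andbC.
rewrite stock_inr in_setU1 in_setD stock_inr => le_bi; apply/orP; right.
apply/andP; split; last lia.
by apply/negP=> /arms_uv; rewrite ltnNge le_bi.
Qed.

Lemma lt_foot a : a < N -> a.*2 < N.*2. Proof. lia. Qed.
Lemma lt_tip a : a < N -> a.*2.+1 < N.*2. Proof. lia. Qed.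

Lemma adj_foot a (ltaN : a < N) : adj (inT (root d)) (arm (Ordinal (lt_foot ltaN))).
Proof. by rewrite armed_adjE /= odd_double eqxx orbT. Qed.

Lemma adj_tip a (ltaN : a < N) :
  adj (arm (Ordinal (lt_tip ltaN))) (arm (Ordinal (lt_foot ltaN))).
Proof.
rewrite armed_adjE /= odd_double /=; apply/orP; left; apply/eqP.
by congr (Some (inr _)); apply: val_inj.
Qed.

(** The pegs of [E] must survive while [y] is being reached.  All the pegs in
    transit are at most as deep as [y], so it suffices that [E] be deeper.  This
    allows first to peg the parent of [y], then the grandparent while the parent
    waits, and finally to jump. *)
Lemma spend_arms (y : node d) (E : {set node d}) a :
  (forall z, z \in E -> depth y < depth z) -> a + arm_cost (depth y) <= N ->
  dominates (stock E a) (stock (y |: E) (a + arm_cost (depth y))).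
Proof.
have at_root (F : {set node d}) b : b < N ->
    dominates (stock F b) (stock (root d |: F) b.+1).
  move=> ltbN; apply: jump_stock (adj_tip ltbN) (adj_foot ltbN) _ _ _.
  - by rewrite stock_inr.
  - by rewrite stock_inr.
  - by apply/eqP=> -[]; lia.
  - by [].
  - by move=> i; rewrite in_set2 => /orP[]/eqP[->] /=; lia.
  by move=> z; rewrite in_setU1 in_set2 => /orP[->|->]; rewrite ?orbT.
have [m] := ubnP (depth y); elim: m y E a => // m IHm y E a lt_ym E_deep.
case Py: (parent y) => [p|]; last first.
  by rewrite (parent_root Py) depth_root addn1 in E_deep *; apply: at_root.
have dy := depth_parent Py; rewrite dy.
case Pp: (parent p) => [q|]; last first.
  have p_root := parent_root Pp.
  rewrite p_root depth_root /= addn2 => leaN.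
  have ltaN : a < N by lia.
  have lta1N : a.+1 < N by lia.
  apply: (dominates_trans (at_root _ _ ltaN)).
  (* the foot of the second arm jumps over the root onto its child *)
  apply: (@jump_stock _ _ _ _ _ _ y) (_ : (arm (Ordinal (lt_foot lta1N))) \in _)
    (_ : inT (root d) \in _) _ _ _ _ _ _.
  - by rewrite stock_inr.
  - by rewrite stock_inl setU11.
  - by [].
  - by rewrite adj_sym adj_foot.
  - by rewrite armed_adjE /= Py p_root eqxx.
  - by [].
  - by move=> i; rewrite in_set2 => /orP[]/eqP // [->] /=; lia.
  move=> z; rewrite in_set2 !in_setU1 => /orP[->//|Ez]; rewrite Ez !orbT /=.
  apply/orP; right; apply/eqP=> -[z_root].
  by have := E_deep _ Ez; rewrite z_root depth_root.
have dp := depth_parent Pp; rewrite dp arm_costSS addnA => leaN.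
have step1 : dominates (stock E a) (stock (p |: E) (a + arm_cost (depth p))).
  apply: IHm; [lia | by move=> z /E_deep; lia | rewrite dp; lia].
apply: dominates_trans step1 _; rewrite dp.
have step2 : dominates (stock (p |: E) (a + arm_cost (depth q).+1))
   (stock (q |: (p |: E)) (a + arm_cost (depth q).+1 + arm_cost (depth q))).
  apply: IHm; [lia | | by []].
  by move=> z; rewrite in_setU1 => /orP[/eqP->|/E_deep]; lia.
apply: dominates_trans step2 _.
apply: (@jump_stock _ _ _ _ _ _ y) (_ : inT q \in _) (_ : inT p \in _) _ _ _ _ _ _.
- by rewrite stock_inl setU11.
- by rewrite stock_inl !inE eqxx orbT.
- by rewrite (inj_eq inl_inj); apply/eqP=> qp; move: dp; rewrite qp; lia.
- by rewrite armed_adjE /= Pp eqxx orbT.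
- by rewrite armed_adjE /= Py eqxx.
- by [].
- by move=> i; rewrite in_set2 => /orP[]/eqP.
move=> z; rewrite in_set2 !in_setU1 => /orP[->//|Ez]; rewrite Ez !orbT /=.
apply/orP; right; rewrite !(inj_eq inl_inj).
by apply/negP=> /orP[] /eqP z_eq; have := E_deep _ Ez; rewrite z_eq; lia.
Qed.

Lemma opt_pegging_arms : arm_cost d <= N -> opt_pegging T <= N.*2.
Proof.
move=> le_dN; have [_ minT] := opt_peggingP T.
have card_stock : #|stock set0 0| = N.*2.
  have -> : stock set0 0 = [set inr i | i : 'I_N.*2].
    apply/setP=> -[z|i]; first by rewrite stock_inl inE; apply/esym/imsetP=> -[].
    by rewrite stock_inr; apply/esym/imset_f.
  by rewrite card_imset ?card_ord //; apply: inr_inj.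
rewrite -[leqRHS]card_stock; apply: minT; apply/eqP/setP=> -[y|i]; rewrite !inE.
  apply: dominates_reachable (spend_arms (y := y) (E := set0) (a := 0) _ _) _.
  - by move=> z; rewrite inE.
  - by rewrite add0n (leq_trans _ le_dN) // arm_cost_mono // depth_le.
  by rewrite stock_inl setU11.
by apply: dominates_reachable (dominates_sub (subxx _)) _; rewrite stock_inr.
Qed.

End Upper.

(** * The bare binary tree *)

(** The hypothesis on [h] says that everything outside a block, fully pegged,
    weighs less than one peg on a target in the block. *)
Section Lower.
Import Order.TTheory GRing.Theory Num.Theory.
Variables (h k : nat).
Hypothesis h_large : (18%:R * (8%:R / 9%:R) ^+ h.+1 < 1 :> rat)%R.
Local Notation T := (armed_tree (k + h) 0).

Let dist (a : address k) (x : T) : nat :=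
  match x with inl y => target_dist a y | inr _ => 0 end.

Let dist_lip (a : address k) (x y : T) : adj x y -> dist a x <= (dist a y).+1.
Proof.
rewrite armed_adjE; case: x y => [x|[]] // [y|[]] //= /orP[]/eqP.
  by case Px: (parent x) => [z|] //= [<-]; have /andP[] := target_dist_lip a Px.
by case Py: (parent y) => [z|] //= [<-]; have /andP[] := target_dist_lip a Py.
Qed.

Lemma meets_block (D : {set T}) (a : address k) : can_peg D ->
  exists2 x, inl x \in D & block x = Some a.
Proof.
move=> pD; have [/existsP[x /andP[Dx /eqP ax]]|no_x] :=
  boolP [exists x, (inl x \in D) && (block x == Some a)]; first by exists x.
have [t dt] := target_dist_target h a.
have: inl t \in reach D by rewrite (eqP pD) inE.
rewrite inE => /(weight_reachable (@dist_lip a)); rewrite [dist _ _]dt expr0.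
rewrite leNgt => /negP[]; apply: le_lt_trans h_large.
have le_out := sum_outside_block h a.
apply: (@le_trans _ _ (\sum_(x : node (k + h) | block x != Some a)
                         ratio ^+ target_dist a x)%R).
  rewrite /weight big_sumType /= [X in (_ + X)%R]big_pred0 ?addr0; last by case.
  rewrite big_mkcond [leRHS]big_mkcond; apply: ler_sum => x _.
  case: ifP => Dx; last by case: ifP => _ //; apply: ratio_ge0.
  rewrite ifT //; apply: contra no_x => /eqP ax; apply/existsP; exists x.
  by rewrite Dx ax eqxx.
apply: le_trans le_out _; rewrite ler_wpM2l // gerBl.
by rewrite exprn_ge0.
Qed.

Lemma opt_pegging_binary : 2 ^ k <= opt_pegging T.
Proof.
have [[D pD <-] _] := opt_peggingP T; rewrite -card_address.
pose blk (x : T) := if x is inl y then block y else None.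
have <- : #|[set Some a | a : address k]| = #|address k|.
  by rewrite card_imset //; apply: Some_inj.
rewrite (leq_trans _ (leq_imset_card blk _)) //.
apply: subset_leq_card; apply/subsetP=> _ /imsetP[a _ ->].
by have [x Dx <-] := meets_block a pD; apply/imsetP; exists (inl x).
Qed.

End Lower.

(** * The family of trees *)

(** The least height for which [block_height_large] holds. *)
Definition block_height := 24.

Lemma block_height_large : (18%:R * (8%:R / 9%:R) ^+ block_height.+1 < 1 :> rat)%R.
Proof. by rewrite /block_height; lra. Qed.

(** The depth of the tree is [4 * m] with [m = block_height + 2 + i].  Then at
    most [2 ^ (3 * m)] arms suffice, while there are [2 ^ (4 * m - block_height)]
    blocks; the summand [2] absorbs that each arm has two vertices and makes the
    inequality strict. *)
Definition blocks_depth i := 4 * (block_height + 2 + i) - block_height.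
Definition tree_depth i := blocks_depth i + block_height.
Definition arms i := arm_cost (tree_depth i).

Lemma tree_depthE i : tree_depth i = 4 * (block_height + 2 + i).
Proof. by rewrite /tree_depth /blocks_depth subnK //; lia. Qed.

Lemma arms_lt i : (arms i).*2 < 2 ^ blocks_depth i.
Proof.
have := arm_cost_mul4 (block_height + 2 + i); rewrite -tree_depthE -/(arms i).
move=> le_arms; have -> : blocks_depth i = (3 * (block_height + 2 + i)).+2 + i.
  by rewrite /blocks_depth; lia.
apply: (@leq_trans (2 ^ (3 * (block_height + 2 + i)).+2)).
  move: (3 * _) le_arms => e le_arms.
  by rewrite !expnS; have := expn_gt0 2 e; lia.
by rewrite leq_exp2l // leq_addr.
Qed.

(** Otherwise the number would not decrease from the bare binary tree to the
    tree with all its arms. *)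
Lemma opt_pegging_drop i : exists n,
  (n < (arms i).*2) &&
  (opt_pegging (armed_tree (tree_depth i) n.+1) <
   opt_pegging (armed_tree (tree_depth i) n)).
Proof.
pose p n := opt_pegging (armed_tree (tree_depth i) n).
have drop : p (arms i).*2 < p 0.
  apply: leq_ltn_trans (opt_pegging_arms (leqnn _)) _.
  exact: leq_trans (arms_lt i) (opt_pegging_binary _ block_height_large).
have [/existsP[n pn]|no_drop] := boolP [exists n : 'I_(arms i).*2, p n.+1 < p n].
  by exists n; rewrite ltn_ord.
move: drop; rewrite ltnNge => /negP[].
elim: {-2}(arms i).*2 (leqnn (arms i).*2) => // n IHn lt_n.
apply: leq_trans (IHn (ltnW lt_n)) _; rewrite leqNgt.
by apply: contra no_drop => pn; apply/existsP; exists (Ordinal lt_n).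
Qed.

Definition drop_arms i := ex_minn (opt_pegging_drop i).

Theorem corollary5p3 :
  exists T : nat -> sgraph,
    (forall i : nat, is_tree (T i) /\
       exists l : T i, leaf l /\ opt_pegging (T i) < opt_pegging (del_vertex l)) /\
    (forall i j : nat, i <> j -> ~ graph_iso (T i) (T j)).
Proof.
exists (fun i => armed_tree (tree_depth i) (drop_arms i).+1); split=> [i|i j ij].
  split; first exact: armed_tree_is_tree.
  exists (inr ord_max); split; first exact: leaf_last_arm.
  rewrite -(iso_opt_pegging (del_last_arm _ _)).
  by rewrite /drop_arms; case: ex_minnP => n /andP[].
wlog lt_ij : i j ij / i < j.
  move=> IH; case: (ltngtP i j) => [|/IH IHji /graph_iso_sym|//]; first exact: IH.
  by apply: IHji => /esym.
case/iso_card/eqP; rewrite -eqSS !card_armed_tree => /eqP eq_card.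
(* the arms are fewer than the nodes, so one more level in the binary tree
   outweighs them *)
have lt_drop m : (drop_arms m).+1 < 2 ^ (tree_depth m).+1.
  rewrite /drop_arms; case: ex_minnP => n /andP[lt_n _] _.
  apply: leq_ltn_trans lt_n (leq_trans (arms_lt m) _).
  by rewrite leq_exp2l // ltnW // ltnS leq_addr.
have: 2 ^ (tree_depth i).+2 <= 2 ^ (tree_depth j).+1.
  by rewrite leq_exp2l // !tree_depthE; lia.
by rewrite expnS; have := lt_drop i; lia.
Qed.
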